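(* Let $p$ be a prime and $d\in\{0,1,\ldots,p\}$. Then $$\sum_{k=0}^{p-1}\binom{2k}{k+d}\equiv\left(\frac{p-d}3\right)\pmod{p},$$ $$\sum_{k=1}^{p-1}k\binom{2k}{k+d} \equiv\left([3\mid p-d]-\frac13\right)\left(2\left(\frac{p-d}3\right)-d\right)-[p=3]\pmod{p},$$ and $$\sum_{k=1}^{p-1}\frac{\binom{2k}{k+d}}k\equiv \begin{cases} d^{-1}\left(-1+2(-1)^d+3[3\mid p-d]\right)\pmod{p}&\text{if } d\neq0,\\ -[p=3]\pmod{p}&\text{if } d=0.\end{cases}$$
   Context: For integers $n,k$, $\binom nk$ is the usual binomial coefficient, equal to $0$ if $k<0$ or $k>n\ge0$. For an integer $a$, $\left(\frac a3\right)$ denotes the unique integer in $\{0,1,-1\}$ congruent to $a$ modulo $3$. For an assertion $A$, $[A]=1$ if $A$ holds and $0$ otherwise. For rational numbers $a,b$, $a\equiv b\pmod p$ means that $a-b=u/v$ with integers $u,v$, $p\nmid v$ and $p\mid u$. *)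

(* Defs.v *)
From mathcomp Require Import all_boot all_order all_algebra.

Set Implicit Arguments.
Unset Strict Implicit.
Unset Printing Implicit Defensive.

Import Order.TTheory GRing.Theory Num.Theory.
Local Open Scope ring_scope.

(* For p prime, the condition ~~ (p %| v) forces v != 0, so u%:Q / v%:Q is a
   genuine fraction. *)
Definition eqmod_rat (p : nat) (a b : rat) : Prop :=
  exists u v : int,
    [/\ a - b = u%:Q / v%:Q, ~~ (p%:Z %| v)%Z & (p%:Z %| u)%Z].

Definition symb3 (a : int) : int :=
  if (a == 1 %[mod 3%:Z])%Z then 1
  else if (a == -1 %[mod 3%:Z])%Z then -1
  else 0.

Lemma symb3_spec (a : int) :
  symb3 a \in [:: 0; 1; -1] /\ (symb3 a = a %[mod 3%:Z])%Z.
Proof.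
rewrite /symb3; case: eqP => [-> //|n1]; case: eqP => [-> //|n2].
split=> //; have := modz_ge0 a (isT : 3%:Z != 0).
have := ltz_pmod a (isT : 0 < 3%:Z).
by case: (a %% 3)%Z n1 n2 => // -[|[|[|n]]].
Qed.

Lemma symb3_unique (a e : int) :
  e \in [:: 0; 1; -1] -> (e = a %[mod 3%:Z])%Z -> e = symb3 a.
Proof.
by rewrite /symb3 !inE => /or3P[] /eqP -> <-.
Qed.

(* Main.v *)
Require Import Defs.
From mathcomp Require Import all_boot all_order all_algebra.
From mathcomp Require Import zify ring.

Set Implicit Arguments.
Unset Strict Implicit.
Unset Printing Implicit Defensive.

Import Order.TTheory GRing.Theory Num.Theory.
Local Open Scope ring_scope.

(* In characteristic p, Pascal's rule applied twice shows that the sums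
   S(d) = \sum_(k < p) 'C(2k, k + d) and T(d) = \sum_(k < p) k 'C(2k, k + d)
   satisfy S(d-1) + S(d) + S(d+1) = 0 and T(d-1) + T(d) + T(d+1) = - S(d) for
   0 < d < p, since p divides 'C(2p, p + d); both are solved downwards from
   d = p.  For U(d) = \sum_(0 < k < p) 'C(2k, k + d) / k with d > 0, the identity
   d 'C(2k, k + d) = k ('C(2k-2, k+d-2) - 'C(2k-2, k+d)) expresses d U(d) through
   S.  Finally 'C(2k, k) = - 2 \sum_(d > 0) (-1)^d 'C(2k, k + d) for k > 0 turns
   U(0) into \sum_(0 < d < p) c(d) (-1)^d / d up to a constant factor, where
   c(d) = 3 [3 | d] - 1; this is \sum_(0 < d < p) c(d) 'C(p, d) / p up to sign,
   which vanishes for p > 3 by the cube-root-of-unity filter. *)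

(** * Binomial identities in even rows, over the naturals *)

Section CentralBinomialSums.
Local Open Scope nat_scope.

Lemma bin_centralS k d :
  'C(2 * k.+1, k.+1 + d.+1)
  = 'C(2 * k, k + d) + 2 * 'C(2 * k, k + d.+1) + 'C(2 * k, k + d.+2).
Proof. by rewrite mulnS add2n addSn !addnS !binS; lia. Qed.

(** Telescoping: by [bin_centralS] the three k-th terms add up to 'C(2k+2, k+d+2) - 'C(2k, k+d+1),
    and 'C(0, d+1) = 0. *)
Lemma sum_bin_central_rec n d :
  \sum_(0 <= k < n) 'C(2 * k, k + d) + \sum_(0 <= k < n) 'C(2 * k, k + d.+1)
    + \sum_(0 <= k < n) 'C(2 * k, k + d.+2) = 'C(2 * n, n + d.+1).
Proof.
elim: n => [|n IHn]; first by rewrite !big_geq // muln0 bin0n.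
by rewrite !big_nat_recr //= bin_centralS; lia.
Qed.

(** Summation by parts on the same telescoping, arranged to avoid natural subtraction. *)
Lemma sum_mul_bin_central_rec n d :
  \sum_(0 <= k < n) k * 'C(2 * k, k + d)
    + \sum_(0 <= k < n) k * 'C(2 * k, k + d.+1)
    + \sum_(0 <= k < n) k * 'C(2 * k, k + d.+2)
    + ('C(2 * n, n + d.+1) + \sum_(0 <= k < n) 'C(2 * k, k + d.+1))
  = n * 'C(2 * n, n + d.+1).
Proof.
rewrite -sum_bin_central_rec.
elim: n => [|n IHn]; first by rewrite !big_geq // muln0 bin0n.
have := sum_bin_central_rec n d; rewrite !big_nat_recr //= => E.
nia.
Qed.

(** The absorption identities [E1] and [E2] for 'C(2k+2, k+d+2) have weights k+d+2 and k-d, which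
    differ by 2(d+1); Pascal's rule in row 2k+1 does the rest. *)
Lemma mul_bin_central k d :
  d.+1 * 'C(2 * k.+1, k.+1 + d.+1) + k.+1 * 'C(2 * k, k + d.+2)
  = k.+1 * 'C(2 * k, k + d).
Proof.
have E1 := mul_bin_diag (2 * k).+2 (k + d).+1.
have E2 := mul_bin_down (2 * k).+2 (k + d).+2.
move: E1 E2; rewrite mulnS add2n addSn !addnS /= => E1 E2.
have B1 := binS (2 * k) (k + d); have B2 := binS (2 * k) (k + d).+1.
(* For d > k the weight k - d truncates, but then all three binomials vanish. *)
have [le|lt] := leqP d k.
  nia.
by rewrite !bin_small //; lia.
Qed.

(** Absorption makes (p+d) 'C(2p, p+d) a multiple of p, and p + d is prime to p. *)
Lemma prime_dvd_bin_double p d :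
  prime p -> 0 < d < p -> p %| 'C(2 * p, p + d).
Proof.
move=> pr_p /andP[d0 ltdp]; have p0 := prime_gt0 pr_p.
have /Gauss_dvdr <- : coprime p (p + d).
  by rewrite prime_coprime // dvdn_addr // gtnNdvd.
have -> : p + d = (p + d.-1).+1 by lia.
by rewrite -mul_bin_diag -mulnA mulnCA dvdn_mulr.
Qed.

Lemma bin_prime_quotient p d :
  prime p -> 0 < d < p -> d * ('C(p, d) %/ p) = 'C(p.-1, d.-1).
Proof.
move=> pr_p d_p; have p0 := prime_gt0 pr_p; case/andP: (d_p) => d0 _.
apply/eqP; rewrite -(eqn_pmul2l p0) mulnCA [p * (_ %/ _)]mulnC.
by rewrite divnK ?prime_dvd_bin // mul_bin_diag prednK.
Qed.
End CentralBinomialSums.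

(** * Alternating row sums, and integer sequences governed by residues modulo 3 *)

Lemma sum_alternating_bin (R : pzRingType) n m d :
  \sum_(1 <= i < m.+1) (-1) ^+ i * 'C(n.+1, d + i)%:R
  = (-1) ^+ m * 'C(n, d + m)%:R - 'C(n, d)%:R :> R.
Proof.
elim: m => [|m IHm]; first by rewrite big_geq // mul1r addn0 subrr.
rewrite big_nat_recr //= IHm addnS binS natrD exprS mulrDr !mulN1r !mulNr.
by rewrite addrC addrA subrK.
Qed.

Definition char3 (n : nat) : int := 3 * (3 %| n)%N%:R - 1.

(* [char3 n] is [w ^ n + w ^ -n] for a primitive cube root of unity [w], and
   [1 + w = - w ^ 2]. *)
Lemma sum_char3_bin n i :
  \sum_(0 <= d < n.+1) char3 (d + i) * 'C(n, d)%:R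
  = (-1) ^+ n * char3 (i + 2 * n) :> int.
Proof.
elim: n i => [|n IHn] i.
  by rewrite big_nat1 mul1r bin0 mulr1 muln0 addn0.
rewrite big_nat_recl // bin0.
rewrite (eq_bigr (fun d => char3 (d.+1 + i) * 'C(n, d.+1)%:R
   + char3 (d + i.+1) * 'C(n, d)%:R)); last first.
  by move=> d _; rewrite binS natrD mulrDr addSnnS.
rewrite big_split /= IHn addrA.
have -> : char3 (0 + i) * 1%:R
    + \sum_(0 <= d < n.+1) char3 (d.+1 + i) * 'C(n, d.+1)%:R =
    (-1) ^+ n * char3 (i + 2 * n).
  rewrite -IHn [RHS]big_nat_recl // bin0; congr (_ + _).
  by rewrite big_nat_recr //= bin_small // mulr0 addr0.
rewrite exprS /char3.
have [-> ->] : (i.+1 + 2 * n = (i + 2 * n) + 1)%N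
  /\ (i + 2 * n.+1 = (i + 2 * n) + 2)%N by lia.
set m := (i + _)%N.
rewrite -mulrDr mulN1r mulNr -mulrN; congr (_ * _).
(* What remains is char3 m + char3 (m+1) + char3 (m+2) = 0, that is, 1 + w + w^2 = 0. *)
by lia.
Qed.

Lemma symb3_natE n :
  symb3 n%:Z = if (n %% 3 == 1)%N then 1 else if (n %% 3 == 2)%N then -1 else 0.
Proof.
rewrite /symb3 modz_nat.
by case: (n %% 3)%N (ltn_pmod n (isT : (0 < 3)%N)) => [|[|[|]]].
Qed.

(* The value of T(p - n), kept integral (no 1/3) so that p = 3 needs no special
   treatment. *)
Definition char3_weight (n : nat) : int :=
  if (n %% 3 == 0)%N then 2 * (n %/ 3)%N%:Z
  else if (n %% 3 == 1)%N then - (n %/ 3).+1%:Z else - (n %/ 3)%N%:Z.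

(** For n = p - d this links the integral value of T(d) to the stated one, since n and -d differ by
    p. *)
Lemma char3_weightE n :
  3 * char3_weight n = char3 n * (2 * symb3 n%:Z + n%:Z).
Proof.
rewrite symb3_natE /char3_weight /char3 /dvdn.
have := divn_eq n 3; have := ltn_pmod n (isT : (0 < 3)%N).
by move: (n %/ 3)%N (n %% 3)%N => q [|[|[|]]] //= _ ->; lia.
Qed.

Lemma symb3_rec n : symb3 n%:Z + symb3 n.+1%:Z + symb3 n.+2%:Z = 0.
Proof.
rewrite !symb3_natE (divn_eq n 3) -!addnS !modnMDl.
by case: (n %% 3)%N (ltn_pmod n (isT : (0 < 3)%N)) => [|[|[|]]].
Qed.

Lemma char3_weight_rec n :
  char3_weight n + char3_weight n.+1 + char3_weight n.+2 = - symb3 n.+1%:Z.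
Proof.
rewrite symb3_natE /char3_weight (divn_eq n 3) -!addnS !modnMDl !divnMDl //.
case: (n %% 3)%N (ltn_pmod n (isT : (0 < 3)%N)) => [|[|[|]]] //= _; lia.
Qed.

(** Evaluates S(d-1) - S(d+1), with n + 1 = p - d. *)
Lemma symb3_diff n : symb3 n.+2%:Z - symb3 n%:Z = char3 n.+1.
Proof.
rewrite !symb3_natE /char3 /dvdn (divn_eq n 3) -!addnS !modnMDl.
by case: (n %% 3)%N (ltn_pmod n (isT : (0 < 3)%N)) => [|[|[|]]].
Qed.

(** * The sums in a field of characteristic p *)

Section PrimeCharacteristic.
Variables (F : fieldType) (p : nat).
Hypothesis charFp : p \in [pchar F].

Let pr_p : prime p := pcharf_prime charFp.
Let p_gt0 : (0 < p)%N := prime_gt0 pr_p.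
Let pF0 : p%:R = 0 :> F := pcharf0 charFp.

Lemma natf_small_neq0 d : (0 < d < p)%N -> d%:R != 0 :> F.
Proof.
by move=> /andP[d0 ltdp]; rewrite -(dvdn_pcharf charFp) gtnNdvd.
Qed.

(** The Frobenius map commutes with negation, which covers p = 2 as well. *)
Lemma signr_pchar : (-1) ^+ p = -1 :> F.
Proof.
by have := pFrobenius_autN charFp 1; rewrite pFrobenius_autE pFrobenius_aut1.
Qed.

Lemma bin_double_pchar d : (0 < d < p)%N -> 'C(2 * p, p + d)%:R = 0 :> F.
Proof.
by move=> dp; apply/eqP; rewrite -(dvdn_pcharf charFp) prime_dvd_bin_double.
Qed.

Lemma bin_pred_pchar d : (d < p)%N -> 'C(p.-1, d)%:R = (-1) ^+ d :> F.
Proof.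
elim: d => [|d IHd] ltdp; first by rewrite bin0.
have /eqP : 'C(p, d.+1)%:R = 0 :> F.
  by apply/eqP; rewrite -(dvdn_pcharf charFp) prime_dvd_bin.
rewrite -{1}(prednK p_gt0) binS natrD IHd ?(ltnW ltdp) // addr_eq0 => /eqP->.
by rewrite exprS mulN1r.
Qed.

(** Induction on j = p - d: for j = 0 every term vanishes, for j = 1 only k = p - 1 contributes, and
    then [symb3_rec] matches the recursion. *)
Lemma sum_bin_central_pchar j : (j <= p)%N ->
  \sum_(0 <= k < p) 'C(2 * k, k + (p - j))%:R = (symb3 j%:Z)%:~R :> F.
Proof.
elim/ltn_ind: j => -[|[|j]] IHj lejp.
- rewrite big_nat big1 // => k /andP[_ ltkp].
  by rewrite bin_small //; lia.
- rewrite -(prednK p_gt0) big_nat_recr //= big_nat big1 => [|k /andP[_ ltkp]].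
    by rewrite subSS subn0 mul2n addnn binn add0r.
  by rewrite bin_small //; lia.
have := sum_bin_central_rec p (p - j.+2) => /(congr1 (fun n => n%:R : F)).
rewrite bin_double_pchar; last by lia.
rewrite !natrD !natr_sum.
have -> : (p - j.+2).+1 = (p - j.+1)%N by lia.
have -> : (p - j.+1).+1 = (p - j)%N by lia.
rewrite (IHj j) ?(IHj j.+1) //; try lia.
move/eqP; rewrite -addrA addr_eq0 -rmorphD -rmorphN /= => /eqP->.
by congr (_%:~R); have := symb3_rec j; lia.
Qed.

Lemma sum_mul_bin_central_pchar j : (j <= p)%N ->
  \sum_(0 <= k < p) (k * 'C(2 * k, k + (p - j)))%:R = (char3_weight j)%:~R :> F.
Proof.
elim/ltn_ind: j => -[|[|j]] IHj lejp.
- rewrite big_nat big1 // => k /andP[_ ltkp].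
  by rewrite bin_small ?muln0 //; lia.
(* The only nonzero term, at k = p - 1, is p - 1, hence -1 in [F]. *)
- have -> : (char3_weight 1)%:~R = p.-1%:R :> F.
    by rewrite -subn1 natrB // pF0 sub0r.
  rewrite -(prednK p_gt0) big_nat_recr //= big_nat big1 => [|k /andP[_ ltkp]].
    by rewrite subSS subn0 mul2n addnn binn add0r muln1.
  by rewrite bin_small ?muln0 //; lia.
have := sum_mul_bin_central_rec p (p - j.+2) => /(congr1 (fun n => n%:R : F)).
rewrite natrM pF0 mul0r !natrD bin_double_pchar; last by lia.
rewrite !natr_sum.
have -> : (p - j.+2).+1 = (p - j.+1)%N by lia.
have -> : (p - j.+1).+1 = (p - j)%N by lia.
rewrite sum_bin_central_pchar ?(ltnW lejp) // add0r (IHj j) ?(IHj j.+1) //; try lia.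
move/eqP; rewrite -!addrA addr_eq0 -!rmorphD -rmorphN /= => /eqP->.
by congr (_%:~R); have := char3_weight_rec j; lia.
Qed.

(** Since row 2p vanishes here, [bin_centralS] gives x_i + 2 x_{i+1} + x_{i+2} = 0, with double
    characteristic root -1; x_0 = 0 and x_1 = 1 fix the solution. *)
Lemma bin_central_pred_pchar i : (i <= p)%N ->
  'C(2 * p.-1, p.-1 + (p - i))%:R = - (-1) ^+ i * i%:R :> F.
Proof.
elim/ltn_ind: i => -[|[|i]] IHi leip.
- by rewrite bin_small ?mulr0 //; lia.
- by rewrite subn1 mul2n addnn binn expr1 opprK mulr1.
have := bin_centralS p.-1 (p - i.+2) => /(congr1 (fun n => n%:R : F)).
rewrite prednK // bin_double_pchar; last by lia.
rewrite 2!natrD natrM.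
have -> : (p - i.+2).+1 = (p - i.+1)%N by lia.
have -> : (p - i.+1).+1 = (p - i)%N by lia.
rewrite (IHi i) ?(IHi i.+1) //; try lia.
move=> /esym/eqP; rewrite -addrA addr_eq0 => /eqP->.
by rewrite !exprS -[i.+2]addn2 -[i.+1]addn1 !natrD; ring.
Qed.

(** By [mul_bin_central] the left side is S(d-1) - S(d+1) with the terms at k = p - 1 removed; these
    removed terms account for 2 (-1)^d. *)
Lemma sum_bin_central_div_pchar d : (0 < d < p)%N ->
  d%:R * \sum_(1 <= k < p) 'C(2 * k, k + d)%:R / k%:R
  = 2 * (-1) ^+ d + (char3 (p - d))%:~R :> F.
Proof.
case: d => [//|d] /andP[_ ltdp].
rewrite big_distrr /= big_add1.
have -> : \sum_(0 <= k < p.-1)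
    d.+1%:R * ('C(2 * k.+1, k.+1 + d.+1)%:R / k.+1%:R : F)
  = \sum_(0 <= k < p.-1) ('C(2 * k, k + d)%:R - 'C(2 * k, k + d.+2)%:R).
  apply: eq_big_nat => k /andP[_ ltkp].
  have k0 : k.+1%:R != 0 :> F by rewrite natf_small_neq0 //; lia.
  rewrite mulrA; apply: (canLR (mulfK k0)); rewrite -natrM mulrBl.
  apply/eqP; rewrite eq_sym subr_eq -!natrM -natrD mulnC.
  by rewrite -mul_bin_central [('C(_, _) * _)%N]mulnC.
have sum_pred e : \sum_(0 <= k < p.-1) 'C(2 * k, k + e)%:R
    = \sum_(0 <= k < p) 'C(2 * k, k + e)%:R - 'C(2 * p.-1, p.-1 + e)%:R :> F.
  by rewrite -[in RHS](prednK p_gt0) big_nat_recr //= addrK.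
rewrite sumrB !sum_pred.
have [j jE] : exists j, p = (j + d.+2)%N by exists (p - d.+2)%N; lia.
have -> : d = (p - j.+2)%N by lia.
have -> : (p - j.+2).+2 = (p - j)%N by lia.
have -> : (p - (p - j.+2).+1 = j.+1)%N by lia.
rewrite !sum_bin_central_pchar ?bin_central_pred_pchar; try lia.
rewrite -symb3_diff rmorphB /=.
have -> : (-1) ^+ (p - j.+2).+1 = - (-1) ^+ j.+1 :> F.
  have -> : (p - j.+2).+1 = (p - j.+1)%N by lia.
  by rewrite -[LHS](signrMK j.+1) -exprD subnKC ?signr_pchar ?mulrN1 //; lia.
by rewrite !exprS -[j.+2]addn2 natrD; ring.
Qed.

(** * The sum with denominators k at d = 0 *)

Lemma big_nat_flip (f : nat -> F) :
  \sum_(1 <= d < p) f d = \sum_(1 <= d < p) f (p - d)%N.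
Proof.
by rewrite big_nat_rev /= add1n; apply: eq_bigr => d _; rewrite subSS.
Qed.

(** Replacing d by p - d negates the sum, and 2 is invertible. *)
Lemma harmonic_pchar : odd p -> \sum_(1 <= d < p) d%:R^-1 = 0 :> F.
Proof.
move=> odd_p; set H := (LHS).
have H2 : H = - H.
  rewrite {1}/H big_nat_flip -sumrN; apply: eq_big_nat => d dp.
  by rewrite natrB ?pF0 ?sub0r ?invrN //; case/andP: dp => _ /ltnW.
have p2 : (2 < p)%N by rewrite odd_prime_gt2.
have /eqP : 2%:R * H = 0 by rewrite mulr_natl mulr2n {2}H2 subrr.
by rewrite mulf_eq0 (negPf (natf_small_neq0 _)) // => /eqP.
Qed.

(** In [F], 'C(p, d) / p equals - (-1)^d / d, so the sum is minus the image of an integer sum that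
    is exactly 0. *)
Lemma sum_char3_alternating_harmonic : (3 < p)%N ->
  \sum_(1 <= d < p) (char3 d)%:~R * ((-1) ^+ d / d%:R) = 0 :> F.
Proof.
move=> p3.
have E : \sum_(1 <= d < p) char3 d * ('C(p, d) %/ p)%N%:R = 0 :> int.
  apply: (@mulfI _ p%:R); first by lia.
  rewrite mulr0 big_distrr /=.
  under eq_big_nat => d dp.
    rewrite mulrCA -natrM [(p * _)%N]mulnC divnK ?prime_dvd_bin //.
  over.
  (* The sum over 0 <= d <= p is - char3 (2p) = 1, and its end terms char3 0 = 2 and char3 p = -1
     already add up to 1. *)
  have := sum_char3_bin p 0; rewrite big_nat_recr //= big_ltn // bin0 binn.
  under eq_bigr => d _ do rewrite addn0.
  rewrite !addn0 add0n -signr_odd (_ : odd p) /char3; last first.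
    by case: (even_prime pr_p) => [|//]; lia.
  have n3 : ~~ (3 %| p)%N by rewrite dvdn_prime2 //; lia.
  have n6 : ~~ (3 %| 2 * p)%N by rewrite Gauss_dvdr.
  rewrite (negPf n3) (negPf n6) dvdn0 expr1.
  by move: (bigop.body _ _ _) => s; lia.
have := congr1 (fun z : int => z%:~R : F) E; rewrite rmorph_sum /= => E'.
apply/eqP; rewrite -oppr_eq0 -sumrN -[X in _ == X]E'.
apply/eqP/eq_big_nat => d dp.
rewrite rmorphM rmorph_nat -mulrN; congr (_ * _).
have d0 := natf_small_neq0 dp; rewrite -mulNr; apply: (canLR (mulfK d0)).
rewrite -natrM mulnC bin_prime_quotient // bin_pred_pchar; last by lia.
by case: d dp {d0} => [//|d] _; rewrite exprS mulN1r opprK.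
Qed.

Lemma sum_bin_central_div0_pchar : (3 < p)%N ->
  \sum_(1 <= k < p) 'C(2 * k, k)%:R / k%:R = 0 :> F.
Proof.
move=> p3.
have odd_p : odd p by case: (even_prime pr_p) => [|//]; lia.
have -> : \sum_(1 <= k < p) 'C(2 * k, k)%:R / k%:R
   = \sum_(1 <= k < p)
       -2%:R * \sum_(1 <= d < p) (-1) ^+ d * 'C(2 * k, k + d)%:R / k%:R :> F.
  apply: eq_big_nat => -[//|k] /andP[_ ltkp].
  rewrite -mulr_suml mulrA; congr (_ / _).
  (* The alternating half-row telescopes to - 'C(2k+1, k+1), which is - 'C(2k+2, k+1) / 2; the range
     of d reaches past the end of the row. *)
  rewrite -[p](prednK p_gt0) mulnS add2n sum_alternating_bin.
  rewrite [X in _ * X%:R]bin_small ?mulr0 ?add0r; last by lia.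
  rewrite mulrNN -natrM; congr (_%:R).
  rewrite binS [RHS]mul2n -[RHS]addnn; congr (_ + _)%N.
  by rewrite -[RHS]bin_sub; [congr 'C(_, _); lia|lia].
rewrite -mulr_sumr exchange_big_nat /=.
have -> : \sum_(1 <= d < p) \sum_(1 <= k < p) (-1) ^+ d * 'C(2 * k, k + d)%:R / k%:R
   = 2 * \sum_(1 <= d < p) d%:R^-1
     + \sum_(1 <= d < p) (char3 d)%:~R * ((-1) ^+ d / d%:R) :> F.
  (* The flip produces char3 (p-d), as in U(d); sign and denominator both change sign, so (-1)^(p-d)
     / (p-d) = (-1)^d / d in [F]. *)
  rewrite [\sum_(1 <= d < p) (char3 d)%:~R * _]big_nat_flip big_distrr -big_split /=.
  apply: eq_big_nat => d dp.
  under eq_bigr => k _ do rewrite -mulrA.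
  have d0 := natf_small_neq0 dp; have led : (d <= p)%N by lia.
  rewrite -mulr_sumr -[X in _ * X](mulKf d0) sum_bin_central_div_pchar //.
  rewrite (natrB _ led) pF0 sub0r invrN.
  have -> : (-1) ^+ (p - d) = - (-1) ^+ d :> F.
    rewrite -signr_odd oddB // odd_p /= -[in RHS]signr_odd.
    by case: odd; rewrite ?opprK.
  have := sqrr_sign F d; rewrite expr2.
  move: ((-1) ^+ d) => s ss.
  by rewrite mulrNN; rewrite -[in RHS](mulr1 2) -ss; ring.
by rewrite harmonic_pchar // sum_char3_alternating_harmonic // !mulr0 addr0 mulr0.
Qed.

End PrimeCharacteristic.

(** * Transfer between p-integral rationals and characteristic p *)

Section Reduction.
Variables (F : fieldType) (p : nat).
Hypothesis charFp : p \in [pchar F].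

(* The graph of the ring morphism from the p-integral rationals to [F]. *)
Definition reduces (q : rat) (x : F) : Prop :=
  exists u v : int,
    [/\ q = u%:Q / v%:Q, ~~ (p%:Z %| v)%Z & x = u%:~R / v%:~R].

Lemma intr_pchar_eq0 (z : int) : (z%:~R == 0 :> F) = (p%:Z %| z)%Z.
Proof.
rewrite dvdzE; case: z => n; first by rewrite -pmulrn -(dvdn_pcharf charFp).
by rewrite NegzE mulrNz oppr_eq0 -pmulrn -(dvdn_pcharf charFp) abszN.
Qed.

Let ndvd_neq0 (v : int) : ~~ (p%:Z %| v)%Z -> v%:Q != 0 /\ v%:~R != 0 :> F.
Proof.
move=> pv; split; last by rewrite intr_pchar_eq0.
by apply: contraNneq pv => /eqP; rewrite intr_eq0 => /eqP->; rewrite dvdz0.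
Qed.

Lemma reduces_int (z : int) : reduces z%:Q z%:~R.
Proof.
exists z, 1; split; rewrite ?divr1 //.
by rewrite -intr_pchar_eq0 oner_eq0.
Qed.

Lemma reduces_nat (n : nat) : reduces n%:R n%:R.
Proof. exact: (reduces_int n%:Z). Qed.

Lemma reducesD a b x y : reduces a x -> reduces b y -> reduces (a + b) (x + y).
Proof.
move=> [u [v [-> pv ->]]] [u' [v' [-> pv' ->]]].
have [v0 vF] := ndvd_neq0 pv; have [v0' vF'] := ndvd_neq0 pv'.
exists (u * v' + u' * v), (v * v'); split; rewrite ?addf_div //.
- by rewrite !rmorphD !rmorphM.
- by rewrite -intr_pchar_eq0 rmorphM mulf_neq0.
- by rewrite !rmorphD !rmorphM.
Qed.

Lemma reducesM a b x y : reduces a x -> reduces b y -> reduces (a * b) (x * y).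
Proof.
move=> [u [v [-> pv ->]]] [u' [v' [-> pv' ->]]].
have [v0 vF] := ndvd_neq0 pv; have [v0' vF'] := ndvd_neq0 pv'.
exists (u * u'), (v * v'); split; rewrite ?mulf_div ?rmorphM //.
by rewrite -intr_pchar_eq0 rmorphM mulf_neq0.
Qed.

Lemma reducesV (n : nat) : ~~ (p %| n)%N -> reduces n%:R^-1 n%:R^-1.
Proof. by move=> pn; exists 1, n%:Z; split; rewrite ?div1r. Qed.

Lemma reduces_sum_nat m n (f : nat -> rat) (g : nat -> F) :
  (forall k, (m <= k < n)%N -> reduces (f k) (g k)) ->
  reduces (\sum_(m <= k < n) f k) (\sum_(m <= k < n) g k).
Proof.
move=> fg; rewrite !big_nat; apply: (big_ind2 reduces) => //.
  exact: (reduces_nat 0).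
by move=> a x b y; apply: reducesD.
Qed.

(** Over the common denominator, the numerator of a - b maps to 0 in [F], so p divides it. *)
Lemma reduces_eqmod a b x : reduces a x -> reduces b x -> eqmod_rat p a b.
Proof.
move=> [u [v [-> pv ->]]] [u' [v' [-> pv' eqx]]].
have [v0 vF] := ndvd_neq0 pv; have [v0' vF'] := ndvd_neq0 pv'.
exists (u * v' - u' * v), (v * v'); split.
- by rewrite -mulNr addf_div // !rmorphB !rmorphM /= mulNr.
- by rewrite -intr_pchar_eq0 rmorphM mulf_neq0.
by rewrite -intr_pchar_eq0 rmorphB !rmorphM subr_eq0 -eqr_div // eqx.
Qed.

End Reduction.

(** * The rational congruences, with small primes and the ends d = 0 and d = p *)

Theorem theorem1p2 (p d : nat) (hp : prime p) (hd : (d <= p)%N) :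
  [/\ eqmod_rat p
        (\sum_(0 <= k < p) ('C(2 * k, k + d))%:R)
        (symb3 (p%:Z - d%:Z))%:Q,
      eqmod_rat p
        (\sum_(1 <= k < p) k%:R * ('C(2 * k, k + d))%:R)
        (((3%:Z %| p%:Z - d%:Z)%Z%:R - 1 / 3%:R)
           * (2%:R * (symb3 (p%:Z - d%:Z))%:Q - d%:R)
         - (p == 3%N)%:R)
    & eqmod_rat p
        (\sum_(1 <= k < p) ('C(2 * k, k + d))%:R / k%:R)
        (if d == 0%N then - (p == 3%N)%:R
         else d%:R^-1
              * (-1 + 2%:R * (-1) ^+ d + 3%:R * (3%:Z %| p%:Z - d%:Z)%Z%:R))].
Proof.
have charFp : p \in [pchar 'F_p] by rewrite pchar_Fp.
have pF0 : p%:R = 0 :> 'F_p := pcharf0 charFp.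
have p_gt0 := prime_gt0 hp.
rewrite subzn // (_ : (3%:Z %| (p - d)%N%:Z)%Z = (3 %| p - d)%N) ?dvdzE //.
have char3Q : (char3 (p - d))%:Q = 3 * (3 %| p - d)%N%:R - 1.
  by rewrite /char3; case: (3 %| p - d)%N.
have dE : d = (p - (p - d))%N by lia.
split.
- apply: (reduces_eqmod charFp _ (reduces_int charFp _)).
  rewrite -(sum_bin_central_pchar charFp) ?leq_subr // -dE.
  by apply: (reduces_sum_nat charFp) => k _; apply: (reduces_nat charFp).
- have: reduces p (\sum_(1 <= k < p) k%:R * 'C(2 * k, k + d)%:R)
          ((char3_weight (p - d))%:~R : 'F_p).
    rewrite -(sum_mul_bin_central_pchar charFp) ?leq_subr // -dE.
    rewrite [X in reduces _ _ X]big_ltn // mul0n add0r.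
    apply: (reduces_sum_nat charFp) => k _; rewrite -natrM.
    exact: (reduces_nat charFp).
  move=> red; apply: (reduces_eqmod charFp red).
  set j := (p - d)%N in red char3Q *; set c := char3 j in char3Q.
  have dQ : d%:R = p%:R - j%:R :> rat by rewrite /j natrB // opprB addrC subrK.
  (* The correction c p / 3 + [p = 3] reduces to 0: for p = 3 it is c + 1 = 3 [3 | j], and otherwise
     3 is invertible modulo p. *)
  have -> : ((3 %| j)%N%:R - 1 / 3) * (2 * (symb3 j)%:~R - d%:R) - (p == 3%N)%:R
      = (char3_weight j)%:~R - (c%:~R * (p%:R / 3) + (p == 3%N)%:R) :> rat.
    have := congr1 (fun z : int => z%:~R : rat) (char3_weightE j).
    rewrite -/c intrM [RHS]intrM char3Q.
    rewrite [(_ + j%:Z)%:~R]intrD [(2 * _)%:~R]intrM => wE.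
    have -> : (char3_weight j)%:~R = (3 * (char3_weight j)%:~R) / 3 :> rat by field.
    by rewrite wE dQ -pmulrn; field.
  rewrite -[(char3_weight j)%:~R in X in reduces _ _ X]addr0.
  apply: (reducesD charFp); first exact: (reduces_int charFp).
  have [p3|p3] := eqVneq p 3%N.
    have -> : - (c%:~R * (p%:R / 3) + 1%:R)
        = (- (p%:Z * (3 %| j)%N%:Z))%:~R :> rat.
      by rewrite char3Q p3 divff // mulr1 subrK rmorphN rmorphM.
    have -> : 0 = (- (p%:Z * (3 %| j)%N%:Z))%:~R :> 'F_p.
      by rewrite rmorphN rmorphM /= -pmulrn pF0 mul0r oppr0.
    exact: (reduces_int charFp).
  have -> : - (c%:~R * (p%:R / 3) + 0%:R) = (- c)%:~R * (p%:R * 3^-1) :> rat.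
    by rewrite addr0 rmorphN mulNr.
  have -> : 0 = (- c)%:~R * (p%:R * 3^-1) :> 'F_p by rewrite pF0 mul0r mulr0.
  apply: (reducesM charFp); first exact: (reduces_int charFp).
  apply: (reducesM charFp); first exact: (reduces_nat charFp).
  by apply: reducesV => //; rewrite dvdn_prime2.
have redU : reduces p (\sum_(1 <= k < p) 'C(2 * k, k + d)%:R / k%:R)
    (\sum_(1 <= k < p) 'C(2 * k, k + d)%:R / k%:R : 'F_p).
  apply: (reduces_sum_nat charFp) => // k /andP[k0 ltkp].
  apply: (reducesM charFp); first exact: (reduces_nat charFp).
  by apply: reducesV => //; rewrite gtnNdvd.
case: eqP => [d0|/eqP]; last rewrite -lt0n => d0.
  have [p3|] := ltnP 3 p.
    move: redU; rewrite d0; under [X in reduces _ _ X]eq_bigr do rewrite addn0.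
    rewrite (sum_bin_central_div0_pchar charFp) // => redU.
    apply: (reduces_eqmod charFp redU); rewrite gtn_eqF // oppr0.
    exact: (reduces_nat charFp 0).
  have p2 := prime_gt1 hp; rewrite leq_eqVlt ltnS => /orP[/eqP p3|le2].
    rewrite d0 p3 big_ltn // big_nat1.
    have [-> ->] : 'C(2 * 1, 1 + 0) = 2%N /\ 'C(2 * 2, 2 + 0) = 6%N by [].
    (* For p = 3 the sum is 2 + 6/2 = 5, against -1. *)
    by exists 6, 1; split=> //; field.
  have -> : p = 2 by apply/anti_leq/andP.
  rewrite d0 big_nat1 (_ : 'C(2 * 1, 1 + 0) = 2%N) //.
  by exists 2, 1; split=> //; field.
move: hd; rewrite leq_eqVlt => /orP[/eqP dp|ltdp].
  rewrite dp subnn big_nat big1 => [|k /andP[_ ltkp]]; last first.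
    by rewrite bin_small ?mul0r //; lia.
  (* As 1/p is not p-integral, the right side is computed over the rationals: it is 2 for p = 2 and
     0 for odd p, while the sum is 0. *)
  have [->|odd_p] := even_prime hp; first by exists (-2), 1.
  rewrite -signr_odd odd_p dvdn0 expr1 mulr1 (_ : _ + _ = 0) ?mulr0 //.
  by apply: (reduces_eqmod charFp); exact: (reduces_nat charFp 0).
have dF := natf_small_neq0 charFp (introT andP (conj d0 ltdp)).
apply: (reduces_eqmod charFp redU).
rewrite -[X in reduces _ _ X](mulKf dF) (sum_bin_central_div_pchar charFp) ?d0 //.
apply: (reducesM charFp); first by apply: reducesV => //; rewrite gtnNdvd.
have -> : -1 + 2 * (-1) ^+ d + 3 * (3 %| p - d)%N%:R
    = (2 * (-1) ^+ d + char3 (p - d))%:~R :> rat.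
  by rewrite intrD char3Q intrM rmorphXn /=; ring.
have -> : 2 * (-1) ^+ d + (char3 (p - d))%:~R
    = (2 * (-1) ^+ d + char3 (p - d))%:~R :> 'F_p.
  by rewrite [in RHS]intrD intrM rmorphXn.
exact: (reduces_int charFp).
Qed.
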